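(* For every integer $d \geq 2$ and $\varepsilon \in (0,1)$, there is an $r=r(d,\varepsilon) \in \mathbb{N}$ such that for all positive integers $n$ and $m$ there is a set $P$ of $n$ points in $\mathbb{R}^d$ and an arrangement $\mathcal{H}$ of $m$ hyperplanes in $\mathbb{R}^d$ such that $K_{r,r} \not\subseteq G(P,\mathcal{H})$ and the number of incidences between $P$ and $\mathcal{H}$ satisfies \[\mathrm{inc}(P,\mathcal{H}) \geq \begin{cases} \Omega_{d,\varepsilon}\left((mn)^{1-(2d+3)/((d+2)(d+3)) - \varepsilon}\right) &\mbox{if } d \mbox{ is odd,} \\ \Omega_{d,\varepsilon}\left((mn)^{1-(2d^2+d-2)/((d+2)(d^2+2d-2)) -\varepsilon}\right) & \mbox{if } d \mbox{ is even.} \end{cases}\]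
   Context: An incidence between a point set $P$ and a hyperplane arrangement $\mathcal{H}$ is a pair $(p,H)$ with $p\in P$, $H\in\mathcal{H}$, $p\in H$; $\mathrm{inc}(P,\mathcal{H})$ denotes the number of incidences. $G(P,\mathcal{H})$ is the bipartite incidence graph on $P\cup\mathcal{H}$ with edges $\{p,H\}$ for incidences $(p,H)$. $\Omega_{d,\varepsilon}$ hides constants depending on $d,\varepsilon$. *)

(* Defs.v *)
From HB Require Import structures.
From mathcomp Require Import all_boot all_order all_algebra.
From mathcomp Require Import reals exp.
Set Implicit Arguments. Unset Strict Implicit. Unset Printing Implicit Defensive.
Import Order.TTheory GRing.Theory Num.Theory.
Local Open Scope ring_scope.

(* A point of R^d is a row vector 'rV[R]_d.  A hyperplane is given by a pair
   (a, b) with a <> 0, standing for the set { x | sum_k a_k x_k = b }. *)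
Definition on_hyp (R : realType) (d : nat) (h : 'rV[R]_d * R) (x : 'rV[R]_d) : bool :=
  \sum_(k < d) h.1 0 k * x 0 k == h.2.

Definition is_hyperplane (R : realType) (d : nat) (h : 'rV[R]_d * R) : Prop :=
  h.1 != 0.

Definition same_hyp (R : realType) (d : nat) (h h' : 'rV[R]_d * R) : Prop :=
  forall x : 'rV[R]_d, on_hyp h x = on_hyp h' x.

Definition inc (R : realType) (d n m : nat)
  (P : 'I_n -> 'rV[R]_d) (H : 'I_m -> 'rV[R]_d * R) : nat :=
  #|[set ij : 'I_n * 'I_m | on_hyp (H ij.2) (P ij.1)]|.

Definition contains_Krr (R : realType) (d n m r : nat)
  (P : 'I_n -> 'rV[R]_d) (H : 'I_m -> 'rV[R]_d * R) : Prop :=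
  exists (A : {set 'I_n}) (B : {set 'I_m}),
    [/\ #|A| = r, #|B| = r &
        forall i j, i \in A -> j \in B -> on_hyp (H j) (P i)].

Definition inc_exponent (R : realType) (d : nat) : R :=
  let D : R := d%:R in
  if odd d then 1 - (2 * D + 3) / ((D + 2) * (D + 3))
  else 1 - (2 * D ^+ 2 + D - 2) / ((D + 2) * (D ^+ 2 + 2 * D - 2)).

(* Main.v *)
Require Import Defs.
From HB Require Import structures.
From mathcomp Require Import all_boot all_order all_algebra.
From mathcomp Require Import zify ring lra.
From mathcomp Require Import reals sequences exp.
Set Implicit Arguments. Unset Strict Implicit. Unset Printing Implicit Defensive.
Import Order.TTheory GRing.Theory Num.Theory.

(* Write d = s + t with s, t within one of d/2, and let U and V be sets of
   integer points in the boxes [X]^(d-1) and [A]^(d-1).  Take the points (x, y)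
   with x in U and the hyperplanes y = a.x + b with a in V, where y and b range
   over intervals of length of order XA: every point lies on exactly |V| of the
   hyperplanes.  In a K_{R,R} the points have distinct x's and the hyperplanes
   distinct a's, and all differences of the x's are orthogonal to all
   differences of the a's; so there is none if any R points of U span
   dimension more than d-1-s and any R points of V more than d-1-t.  A random
   choice gives such sets with |U| about X^s and |V| about A^t, up to small
   powers of X and A.  Solving n = X^(s+1) A, m = A^(t+1) X for X and A yields
   mn / (XA) incidences.  When m <= n one takes t <= s, so that XA is at most
   (mn)^(d / (2 (st + s + t))), and symmetrically otherwise; this exponent is
   at most the one required.  If m and n are too unbalanced for X or A to be
   large, putting all points on one hyperplane (or all hyperplanes through one
   point) suffices. *)

Local Open Scope ring_scope.
Local Open Scope nat_scope.

(** * Selecting rows and columns of a matrix of bounded rank *)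

(** A maximal independent family of rows is padded with row 0 to length exactly [k], so that the
    possible selections form a function space of known size. *)
Lemma rank_rowsub (F : fieldType) (m n k : nat) (M : 'M[F]_(m.+1, n)) :
  \rank M <= k -> exists I : {ffun 'I_k -> 'I_m.+1}, (M <= rowsub I M)%MS.
Proof.
move=> Mk.
pose I : {ffun 'I_k -> 'I_m.+1} :=
  [ffun i : 'I_k => if insub (i : nat) is Some j then maxrankfun M j else ord0].
exists I; rewrite -{1}(eq_maxrowsub M); apply/row_subP => i.
have -> : row i (rowsub (maxrankfun M) M) = row (widen_ord Mk i) (rowsub I M).
  by apply/rowP => j; rewrite !mxE ffunE /= valK.
exact: row_sub.
Qed.

(** The columns [J] span all columns, so [M] is [colsub J M] times a fixed matrix; a combination of
    rows that vanishes on [J] is therefore zero. *)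
Lemma rowspace_colsub_eq0 (F : fieldType) (m n k p : nat) (M : 'M[F]_(m, n))
    (J : {ffun 'I_k -> 'I_n}) (A : 'M[F]_(p, n)) :
  (M^T <= rowsub J M^T)%MS -> (A <= M)%MS -> colsub J A = 0%R -> A = 0%R.
Proof.
move=> /submxP[Y MY] /submxP[C ->] CJ0.
have -> : M = (colsub J M *m Y^T)%R.
  rewrite -[LHS]trmxK MY trmx_mul; congr (_ *m _)%R.
  by apply/matrixP=> i j; rewrite !mxE.
by rewrite mulmxA mulmx_colsub CJ0 mul0mx.
Qed.

(** * Large grid subsets in which tuples of distinct points have large affine dimension *)

Definition grid (D X : nat) : predArgType := {ffun 'I_D -> 'I_X}.

Section Evasive.
Variables (F : numFieldType) (D X : nat).

(** Row 0 is zero; the rank is the dimension of the affine span of the tuple. *)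
Definition offset_mx (r : nat) (x : 'I_r.+1 -> grid D X) : 'M[F]_(r.+1, D) :=
  \matrix_(i, j) ((x i j)%:R - (x ord0 j)%:R)%R.

Definition evasive (r k : nat) (U : {set grid D X}) : Prop :=
  forall x : 'I_r.+1 -> grid D X,
    injective x -> (forall i, x i \in U) -> k < \rank (offset_mx x).

(** Tuples with repetitions are included on purpose: a constant tuple has rank 0, so avoiding this
    set also bounds the fibres of a random map. *)
Definition degenerate (r k : nat) : {set {ffun 'I_r.+1 -> grid D X}} :=
  [set x : {ffun 'I_r.+1 -> grid D X} | \rank (offset_mx x) <= k].
End Evasive.

(* A degenerate tuple x is recovered from k rows spanning the row space of its
   offset matrix, k columns on which vectors of that space are determined, the
   points x_0 and x_i for the chosen rows i, and the chosen columns of every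
   x_i. *)
Lemma card_degenerate (F : numFieldType) (D X r k : nat) :
  #|degenerate F D.+1 X r k| <=
  r.+1 ^ k * D.+1 ^ k * (X ^ D.+1 * (X ^ D.+1) ^ k * X ^ (r.+1 * k)).
Proof.
set T := grid D.+1 X.
have ex (x : {ffun 'I_r.+1 -> T}) : x \in degenerate F D.+1 X r k ->
    exists IJ : {ffun 'I_k -> 'I_r.+1} * {ffun 'I_k -> 'I_D.+1},
      let M := offset_mx F x in
      (M <= rowsub IJ.1 M)%MS && (M^T <= rowsub IJ.2 M^T)%MS.
  rewrite inE => rk; have [I hI] := rank_rowsub rk.
  have [|J hJ] := @rank_rowsub _ _ _ k (offset_mx F x)^T; first by rewrite mxrank_tr.
  by exists (I, J); rewrite /= hI hJ.
pose IJ (x : 'I_r.+1 -> T) : {ffun 'I_k -> 'I_r.+1} * {ffun 'I_k -> 'I_D.+1} :=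
  odflt ([ffun=> ord0], [ffun=> ord0])
  [pick IJ : {ffun 'I_k -> 'I_r.+1} * {ffun 'I_k -> 'I_D.+1} |
      let M := offset_mx F x in
      (M <= rowsub IJ.1 M)%MS && (M^T <= rowsub IJ.2 M^T)%MS].
have IJP (x : {ffun 'I_r.+1 -> T}) : x \in degenerate F D.+1 X r k ->
    let M := offset_mx F x in
      (M <= rowsub (IJ x).1 M)%MS && (M^T <= rowsub (IJ x).2 M^T)%MS.
  by move=> /ex [ij hij]; rewrite /IJ; case: pickP => [//|/(_ ij)]; rewrite hij.
pose code (x : {ffun 'I_r.+1 -> T}) :=
  (IJ x, (x ord0, [ffun i => x ((IJ x).1 i)],
    [ffun ij : 'I_r.+1 * 'I_k => x ij.1 ((IJ x).2 ij.2)])).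
have inj : {in degenerate F D.+1 X r k &, injective code}.
  move=> x x' /IJP hx /IJP hx' []; move: hx hx'; rewrite /=.
  case: (IJ x) => I J; case: (IJ x') => I' J' /=.
  move=> /andP[hI hJ] /andP[hI' _] [eI eJ]; move: hI'; rewrite -{}eI -{}eJ => hI'.
  move=> e0 /ffunP eq1 /ffunP eq2.
  have eM : rowsub I (offset_mx F x') = rowsub I (offset_mx F x).
    by apply/matrixP=> i j; rewrite !mxE e0; have := eq1 i; rewrite !ffunE => ->.
  rewrite eM in hI'.
  (* Both matrices lie in the span of the common rows [I], hence so does their difference, which is
     then determined by its columns [J]. *)
  have d0 : (offset_mx F x - offset_mx F x')%R = 0%R.
    apply: (rowspace_colsub_eq0 hJ).
      apply: submx_trans (rowsub_sub I _).
      by apply: addmx_sub => //; rewrite eqmx_opp.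
    apply/matrixP=> i j; rewrite !mxE e0; have := eq2 (i, j); rewrite !ffunE /= => ->.
    by rewrite subrr.
  apply/ffunP=> i; apply/ffunP=> j.
  have /matrixP/(_ i j) := d0; rewrite !mxE e0 => /eqP.
  rewrite opprB addrA subrK subr_eq0 eqr_nat => /eqP e.
  exact: val_inj.
rewrite -(card_in_imset inj); apply: leq_trans (max_card _) _.
by rewrite !card_prod !card_ffun !card_prod !card_ord.
Qed.

(** A map is recorded by its values along [g], an element of [B], and by its values off the image of
    [g]; overwriting the image with [t0] leaves [#|T| ^ (n - r)] possibilities for the second
    record. *)
Lemma card_ffun_comp (T : finType) (n r : nat) (B : {set {ffun 'I_r -> T}})
    (g : {ffun 'I_r -> 'I_n}) : 0 < #|T| -> injective g ->
  #|[set f : {ffun 'I_n -> T} | [ffun i => f (g i)] \in B]|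
    <= #|B| * #|T| ^ (n - r).
Proof.
move=> /card_gt0P[t0 _] injg.
pose code (f : {ffun 'I_n -> T}) : {ffun 'I_r -> T} * {ffun 'I_n -> T} :=
  ([ffun i => f (g i)], [ffun i => if i \in codom g then t0 else f i]).
have inj : injective code.
  move=> f f' [/ffunP e1 /ffunP e2]; apply/ffunP => i.
  have [/codomP[j ->]|ni] := boolP (i \in codom g).
    by have := e1 j; rewrite !ffunE.
  by have := e2 i; rewrite !ffunE (negPf ni).
pose C := [set f | f \in pffun_on t0 [predC codom g] T].
have -> : #|B| * #|T| ^ (n - r) = #|setX B C|.
  rewrite cardsX cardsE card_pffun_on; congr (_ * _ ^ _).
  by have := cardC (mem (codom g)); rewrite (card_codom injg) !card_ord => e;
    by rewrite -(addKn r #|_|); congr (_ - _); rewrite -[LHS]e.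
rewrite -(card_imset _ inj); apply: subset_leq_card.
apply/subsetP=> _ /imsetP[f + ->]; rewrite !inE => ->; rewrite /=.
apply/pffun_onP; split=> //; apply/supportP=> i.
by rewrite inE negbK ffunE => ->.
Qed.

(** Union bound over the injective index tuples [g]: some map from ['I_n] to the grid is degenerate
    along none of them, and [U] is its image. *)
Lemma exists_evasive (F : numFieldType) (D X r k n : nat) : 0 < X ->
  n ^ r.+1 * (r.+1 ^ k * D.+1 ^ k * (X ^ D.+1 * (X ^ D.+1) ^ k * X ^ (r.+1 * k)))
    < (X ^ D.+1) ^ r.+1 ->
  exists U : {set grid D.+1 X},
    [/\ #|U| <= n, n <= r.+1 * #|U| & evasive F r k U].
Proof.
set N := (X in n ^ r.+1 * X) => X0 lt.
set T := grid D.+1 X.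
have cT : #|T| = X ^ D.+1 by rewrite card_ffun !card_ord.
have T0 : 0 < #|T| by rewrite cT expn_gt0 X0.
pose bad (g : {ffun 'I_r.+1 -> 'I_n}) :=
  [set f : {ffun 'I_n -> T} | [ffun i => f (g i)] \in degenerate F D.+1 X r k].
have [f fP] : exists f : {ffun 'I_n -> T},
    forall g : {ffun 'I_r.+1 -> 'I_n}, injectiveb g -> f \notin bad g.
  pose Bad := \bigcup_(g : {ffun 'I_r.+1 -> 'I_n} | injectiveb g) bad g.
  (* For [n <= r] there is no injective [g], and any map will do. *)
  have [rn|nr] := leqP r.+1 n; last first.
    have /card_gt0P[t0 _] := T0.
    exists [ffun=> t0] => g /injectiveP/leq_card; rewrite !card_ord; lia.
  have BadT : #|Bad| < #|{ffun 'I_n -> T}|.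
    apply: (@leq_ltn_trans (\sum_(g : {ffun 'I_r.+1 -> 'I_n}) N * #|T| ^ (n - r.+1))).
      rewrite [leqRHS](bigID (fun g : {ffun 'I_r.+1 -> 'I_n} => injectiveb g)) /=.
      apply: leq_trans (leq_addr _ _).
      rewrite /Bad; elim/big_rec2: _ => [|g b U gi bU]; first by rewrite cards0.
      apply: leq_trans (leq_card_setU _ _) (leq_add _ bU).
      apply: leq_trans (card_ffun_comp _ T0 _) _; first exact/injectiveP.
      by rewrite leq_mul2r card_degenerate orbT.
    have -> : #|{ffun 'I_n -> T}| = #|T| ^ (n - r.+1) * #|T| ^ r.+1.
      by rewrite card_ffun card_ord -expnD subnK.
    rewrite sum_nat_const card_ffun !card_ord mulnA mulnC.
    by rewrite ltn_pmul2l ?expn_gt0 ?T0 // cT.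
  have /subsetPn[f _ fB] : ~~ ([set: {ffun 'I_n -> T}] \subset Bad).
    by apply: contraL BadT => /subset_leq_card; rewrite cardsT -leqNgt.
  exists f => g gi; apply: contra fB => fg; apply/bigcupP; by exists g.
exists (f @: 'I_n); split.
- by rewrite -[X in _ <= X]card_ord; exact: leq_imset_card.
- have {1}-> : n = \sum_(i in 'I_n) 1 by rewrite sum1_card card_ord.
  rewrite (partition_big_imset f) /= mulnC -sum_nat_const; apply: leq_sum => t _.
  rewrite sum1_card leqNgt; apply/negP=> rf.
  (* A fibre with more than [r.+1] elements would contain an injective index tuple on which [f] is
     constant, hence degenerate. *)
  pose g := [ffun i : 'I_r.+1 => enum_val (widen_ord (ltnW rf) i)].
  have gi : injectiveb g.
    by apply/injectiveP=> i j; rewrite !ffunE => /enum_val_inj/(congr1 val)/= /val_inj.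
  have /negP := fP g gi; apply; rewrite !inE.
  suff -> : offset_mx F [ffun i => f (g i)] = 0%R by rewrite mxrank0.
  apply/matrixP=> i j; rewrite !mxE.
  have fg l : [ffun i => f (g i)] l = t.
    by rewrite !ffunE; apply/eqP/(enum_valP (widen_ord (ltnW rf) l)).
  by rewrite !fg subrr.
- move=> x xi xU.
  have ex i : exists j, f j == x i.
    by have /imsetP[j _ ->] := xU i; exists j.
  pose g := [ffun i => xchoose (ex i)].
  have fg i : f (g i) = x i by rewrite ffunE; apply/eqP/(xchooseP (ex i)).
  have gi : injectiveb g.
    by apply/injectiveP => i j eg; apply: xi; rewrite -!fg eg.
  have := fP g gi; rewrite !inE -ltnNge => lt'.
  suff -> : offset_mx F x = offset_mx F [ffun i => f (g i)] by [].
  by apply/matrixP=> i j; rewrite !mxE ffunE fg ffunE fg.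
Qed.

(** For [X = Y ^ q] the critical size is [X ^ s]. Giving up one factor [Y] gains [Y ^ r.+1] in the
    union bound: [Y ^ r] pays for the [k + 1] points of the code stored in full, and the last [Y]
    for the constant [(r.+1 * D.+1) ^ k]. *)
Lemma exists_evasive_power (F : numFieldType) (D s q r : nat) :
    0 < s <= D.+1 -> 0 < q -> q * D.+1 * (D.+1 - s).+1 <= r ->
  exists2 Y0, 0 < Y0 & forall Y, Y0 <= Y ->
    exists U : {set grid D.+1 (Y ^ q)},
      [/\ #|U| <= Y ^ (s * q - 1), Y ^ (s * q - 1) <= r.+1 * #|U|
        & evasive F r (D.+1 - s) U].
Proof.
move=> /andP[s0 sD] q0 rD; set k := D.+1 - s in rD *.
exists ((r.+1 * D.+1) ^ k).+1 => // Y YY.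
have Y0 : 0 < Y by lia.
apply: exists_evasive; first by rewrite expn_gt0 Y0.
rewrite -!expnMn -!expnM mulnA mulnCA -!expnD.
have -> : Y ^ (q * D.+1 * r.+1) = Y ^ ((s * q - 1) * r.+1 + q * (k * r.+1)) * Y ^ r.+1.
  rewrite -expnD; congr (_ ^ _).
  have -> : D.+1 = s + k by rewrite subnKC.
  have sq0 : 0 < s * q by rewrite muln_gt0 s0.
  by rewrite mulnDr (mulnC q s) -{1}(subnK sq0); ring.
apply: (@leq_trans (Y ^ ((s * q - 1) * r.+1 + q * (k * r.+1)) *
   (Y * Y ^ (q * D.+1 * k.+1)))); last first.
  by rewrite -expnS leq_mul2l leq_pexp2l ?orbT //.
rewrite (mulnS (q * D.+1)) (mulnC k) [in X in _ < X]expnD.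
set a := Y ^ _; set b := Y ^ _; set c := Y ^ _; set C := _ ^ k in YY *.
rewrite (_ : a * (b * C * c) = b * c * a * C); last by ring.
rewrite (_ : b * c * (Y * a) = b * c * a * Y); last by ring.
by rewrite ltn_pmul2l // !muln_gt0 !expn_gt0 Y0.
Qed.

(** * Points and hyperplanes with integer coordinates *)

Section Configuration.
Variables (R : realType) (D : nat).

(** The last coordinate is an integer rather than a natural number, to leave negative heights for
    objects without incidences. *)
Definition lattice_pt (x : 'I_D -> nat) (y : int) : 'rV[R]_D.+1 :=
  \row_k (if unlift ord_max k is Some j then (x j)%:R else y%:~R)%R.

Definition lattice_hyp (a : 'I_D -> nat) (b : int) : 'rV[R]_D.+1 * R :=
  ((\row_k (if unlift ord_max k is Some j then - (a j)%:R else 1))%R, b%:~R)%R.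

Lemma on_lattice_hyp a b x y :
  on_hyp (lattice_hyp a b) (lattice_pt x y)
  = (y == b + (\sum_j a j * x j)%N%:Z :> int)%R.
Proof.
rewrite /on_hyp big_ord_recr /= !mxE unlift_none mul1r.
under eq_bigr => j _.
  have -> : widen_ord (leqnSn D) j = lift ord_max j.
    by apply: val_inj; rewrite /= /bump leqNgt ltn_ord.
  rewrite !mxE liftK mulNr -natrM; over.
rewrite sumrN -natr_sum addrC subr_eq -(eqr_int R) rmorphD /=.
by rewrite -pmulrn.
Qed.

Lemma is_hyperplane_lattice a b : is_hyperplane (lattice_hyp a b).
Proof.
apply/eqP => /rowP/(_ ord_max); rewrite !mxE unlift_none; exact/eqP/oner_neq0.
Qed.

Lemma lattice_pt_inj x y x' y' :
  lattice_pt x y = lattice_pt x' y' -> x =1 x' /\ y = y'.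
Proof.
move=> /rowP e; split=> [j|].
  have := e (lift ord_max j); rewrite !mxE liftK => /eqP.
  by rewrite eqr_nat => /eqP.
by have := e ord_max; rewrite !mxE unlift_none => /intr_inj.
Qed.

(** Testing on a point over the origin recovers [b]; points over the unit vectors then recover
    [a]. *)
Lemma lattice_hyp_inj a b a' b' :
  same_hyp (lattice_hyp a b) (lattice_hyp a' b') -> a =1 a' /\ b = b'.
Proof.
move=> same.
have eb : b = b'.
  have := same (lattice_pt (fun=> 0) b); rewrite !on_lattice_hyp.
  by rewrite !big1 ?addr0 ?eqxx; [move/esym/eqP | move=> *; rewrite muln0 ..].
have delta f j : (\sum_(i < D) f i * (i == j))%N = f j.
  rewrite (bigD1 j) //= eqxx muln1 big1 ?addn0 // => i /negPf ->.
  exact: muln0.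
split=> // j; have := same (lattice_pt (fun i => (i == j) : nat) (b + (a j)%:Z)%R).
by rewrite !on_lattice_hyp -eb !delta eqxx => /esym/eqP/addrI[].
Qed.

(** Heights run over [y0 .. y0 + l - 1] and intercepts over [0 .. y0 + l - 1], so each point over
    [U] meets a hyperplane of every slope in [V]. A biclique would produce distinct [x_i] and
    distinct [a_j] with orthogonal offsets. *)
Lemma lattice_config (X A l y0 n m r : nat)
    (U : {set grid D X}) (V : {set grid D A}) :
    (forall x a, x \in U -> a \in V -> \sum_j a j * x j <= y0) ->
    #|U| * l <= n -> #|V| * (y0 + l) <= m ->
    (forall (x : 'I_r.+1 -> grid D X) (a : 'I_r.+1 -> grid D A),
      injective x -> injective a ->
      (forall i, x i \in U) -> (forall i, a i \in V) ->
      (offset_mx R a *m (offset_mx R x)^T)%R <> 0%R) ->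
  exists (P : 'I_n -> 'rV[R]_D.+1) (H : 'I_m -> 'rV[R]_D.+1 * R),
    [/\ injective P,
        forall j, is_hyperplane (H j),
        forall j j', same_hyp (H j) (H j') -> j = j',
        ~ contains_Krr r.+1 P H &
        #|U| * l * #|V| <= inc P H].
Proof.
move=> UV Un Vm noK.
pose SP := setX U [set: 'I_l]; pose SH := setX V [set: 'I_(y0 + l)].
have cP : #|SP| = #|U| * l by rewrite cardsX cardsT card_ord.
have cH : #|SH| = #|V| * (y0 + l) by rewrite cardsX cardsT card_ord.
pose pI (i : 'I_n) : option 'I_#|SP| := insub (i : nat).
pose hI (i : 'I_m) : option 'I_#|SH| := insub (i : nat).
(* Fillers: points on the last axis at negative even heights and horizontal
   hyperplanes at negative odd heights are in no incidence at all. *)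
pose Px i (j : 'I_D) : nat := if pI i is Some u then (enum_val u).1 j else 0.
pose Py i : int := if pI i is Some u then (y0 + (enum_val u).2)%N%:Z
                   else (- (i.*2.+2)%:Z)%R.
pose Ha i (j : 'I_D) : nat := if hI i is Some u then (enum_val u).1 j else 0.
pose Hb i : int := if hI i is Some u then ((enum_val u).2 : nat)%:Z
                   else (- (i.*2.+1)%:Z)%R.
pose P i := lattice_pt (Px i) (Py i); pose H i := lattice_hyp (Ha i) (Hb i).
have onE i j : on_hyp (H j) (P i) =
    (Py i == Hb j + (\sum_k Ha j k * Px i k)%N%:Z :> int)%R.
  exact: on_lattice_hyp.
(* A filler has [x = 0] or [a = 0], so only heights matter: signs differ in a mixed pair, parities
   in a pair of fillers. *)
have real i j : on_hyp (H j) (P i) -> pI i /\ hI j.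
  rewrite onE /Py /Hb /Ha /Px; case: (pI i) (hI j) => [u|] [v|] //.
  - by rewrite big1 // => /eqP; lia.
  - by rewrite big1 => [/eqP|k _]; [lia | rewrite muln0].
have pIval i u : pI i = Some u -> u = i :> nat.
  by rewrite /pI; case: insubP => // v _ <- [->].
have hIval i u : hI i = Some u -> u = i :> nat.
  by rewrite /hI; case: insubP => // v _ <- [->].
exists P, H; split.
- move=> i i' /lattice_pt_inj[]; rewrite /Px /Py => ex ey; apply: val_inj.
  case E: (pI i) ex ey => [u|]; case E': (pI i') => [u'|] ex ey /=; try by lia.
  rewrite -(pIval _ _ E) -(pIval _ _ E'); congr nat_of_ord; apply: enum_val_inj.
  apply: injective_projections; last by apply: val_inj; case: ey => /addnI.
  by apply/ffunP => j; apply: val_inj; exact: ex.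
- by move=> j; exact: is_hyperplane_lattice.
- move=> i i' /lattice_hyp_inj[]; rewrite /Ha /Hb => ex ey; apply: val_inj.
  case E: (hI i) ex ey => [u|]; case E': (hI i') => [u'|] ex ey /=; try by lia.
  rewrite -(hIval _ _ E) -(hIval _ _ E'); congr nat_of_ord; apply: enum_val_inj.
  apply: injective_projections; last by apply: val_inj; case: ey.
  by apply/ffunP => j; apply: val_inj; exact: ex.
- case=> I [J [cI cJ IJ]].
  have i0 : 'I_#|I| by rewrite cI; exact: ord0.
  have j0 : 'I_#|J| by rewrite cJ; exact: ord0.
  pose f (i : 'I_r.+1) : 'I_n := enum_val (cast_ord (esym cI) i).
  pose g (i : 'I_r.+1) : 'I_m := enum_val (cast_ord (esym cJ) i).
  have fI i : f i \in I by exact: enum_valP.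
  have gJ i : g i \in J by exact: enum_valP.
  have fi : injective f by move=> i i' /enum_val_inj/cast_ord_inj.
  have gi : injective g by move=> i i' /enum_val_inj/cast_ord_inj.
  have [u uE] : exists u, forall i, pI (f i) = Some (u i).
    apply: (@fin_all_exists _ _ (fun i v => pI (f i) = Some v)) => i.
    have [+ _] := real _ _ (IJ _ _ (fI i) (gJ ord0)).
    by case: (pI _) => // v _; exists v.
  have [v vE] : exists v, forall i, hI (g i) = Some (v i).
    apply: (@fin_all_exists _ _ (fun i v => hI (g i) = Some v)) => i.
    have [_] := real _ _ (IJ _ _ (fI ord0) (gJ i)).
    by case: (hI _) => // w _; exists w.
  pose x i := (enum_val (u i)).1; pose a i := (enum_val (v i)).1.
  pose y i : nat := y0 + (enum_val (u i)).2; pose b i : nat := (enum_val (v i)).2.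
  have yE i j : y i = b j + \sum_k a j k * x i k.
    have := IJ _ _ (fI i) (gJ j).
    by rewrite onE /Py /Hb /Ha /Px uE vE -PoszD => /eqP[].
  (* On the single hyperplane [g ord0], [x] determines the height and hence the point; [a] is
     treated dually. *)
  have xi : injective x.
    move=> i i' e; apply: fi; apply: val_inj => /=.
    rewrite -(pIval _ _ (uE i)) -(pIval _ _ (uE i')).
    congr nat_of_ord; apply: enum_val_inj; apply: injective_projections => //.
    have := yE i ord0; rewrite e -(yE i') /y => /addnI; exact: val_inj.
  have ai : injective a.
    move=> i i' e; apply: gi; apply: val_inj => /=.
    rewrite -(hIval _ _ (vE i)) -(hIval _ _ (vE i')).
    congr nat_of_ord; apply: enum_val_inj; apply: injective_projections => //.
    have := yE ord0 i; rewrite e (yE ord0 i') => /addIn /esym; exact: val_inj.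
  apply: (noK x a xi ai).
  + by move=> i; have := enum_valP (u i); rewrite inE => /andP[].
  + by move=> i; have := enum_valP (v i); rewrite inE => /andP[].
  apply/matrixP=> j i; rewrite !mxE.
  have dot j' i' : (\sum_k (a j' k)%:R * (x i' k)%:R = (y i')%:R - (b j')%:R :> R)%R.
    by rewrite (yE i' j') natrD addrC addKr natr_sum; apply: eq_bigr => k _; rewrite natrM.
  (* Since [a_j.x_i = y_i - b_j] separates the two indices, its mixed second difference vanishes. *)
  transitivity ((y i)%:R - (b j)%:R - ((y ord0)%:R - (b j)%:R)
    - ((y i)%:R - (b ord0)%:R) + ((y ord0)%:R - (b ord0)%:R) : R)%R; last by ring.
  rewrite -!dot -!sumrB -big_split /=; apply: eq_bigr => k _; rewrite !mxE; ring.
- have surjP p : p \in SP -> exists i, omap enum_val (pI i) = Some p.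
    move=> pS; have lt : enum_rank_in pS p < n.
      by apply: leq_trans (ltn_ord _) _; rewrite cP.
    by exists (Ordinal lt); rewrite /pI /= valK /= enum_rankK_in.
  have surjH h : h \in SH -> exists j, omap enum_val (hI j) = Some h.
    move=> hS; have lt : enum_rank_in hS h < m.
      by apply: leq_trans (ltn_ord _) _; rewrite cH.
    by exists (Ordinal lt); rewrite /hI /= valK /= enum_rankK_in.
  (* Incidences are projected to pairs of a point and a slope, forgetting the intercept; every pair
     in [SP] times [V] is hit. *)
  pose G (ij : 'I_n * 'I_m) :=
    (omap enum_val (pI ij.1), omap (fun v => (enum_val v).1) (hI ij.2)).
  pose S w : option (grid D X * 'I_l) * option (grid D A) := (Some w.1, Some w.2).
  have Sinj : injective S by move=> [w1 w2] [w1' w2'] [-> ->].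
  rewrite -cP -cardsX -(card_imset _ Sinj).
  apply: leq_trans (leq_imset_card G _); apply: subset_leq_card.
  apply/subsetP=> _ /imsetP[[[x z] a] + ->]; rewrite in_setX /= => /andP[xzS aV].
  have xU : x \in U by move: xzS; rewrite inE => /andP[].
  have le := UV x a xU aV.
  (* This is the intercept of the required hyperplane; [a.x <= y0] makes the subtraction exact. *)
  have lt : y0 + z - \sum_j a j * x j < y0 + l by have := ltn_ord z; lia.
  have hS : (a, Ordinal lt) \in SH by rewrite !inE aV.
  have [i iE] := surjP _ xzS; have [j jE] := surjH _ hS.
  apply/imsetP; exists (i, j); last first.
    by rewrite /G /S /= iE; case: (hI j) jE => //= v [->].
  rewrite inE /= onE /Py /Hb /Px /Ha.
  case: (pI i) iE => //= u [->]; case: (hI j) jE => //= v [->] /=.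
  by rewrite -PoszD subnK // (leq_trans le) ?leq_addr.
Qed.
End Configuration.

(** * Choice of the two scales, in logarithmic coordinates *)

Local Open Scope ring_scope.

Lemma natr_expR_ln (R : realType) (n : nat) :
  (0 < n)%N -> n%:R = expR (ln n%:R) :> R.
Proof. by move=> n0; rewrite lnK // posrE ltr0n. Qed.

(** Rounding down a real that is at least 1 loses at most a factor 2, whence the [ln 2]. *)
Lemma exists_natr_expR (R : realType) (Y0 : nat) (y : R) :
  (0 < Y0)%N -> ln Y0%:R <= y ->
  exists2 Y : nat, (Y0 <= Y)%N & (expR (y - ln 2) <= Y%:R <= expR y).
Proof.
move=> Y00 yY.
have Ye : Y0%:R <= expR y by rewrite natr_expR_ln // ler_expR.
have /andP[le lt] := truncn_itv (expR_ge0 y).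
exists (Num.truncn (expR y)); first by rewrite truncn_ge_nat // expR_ge0.
rewrite le andbT expRB lnK ?posrE // ler_pdivrMr //.
have : (1 <= Num.truncn (expR y))%N.
  by rewrite (leq_trans Y00) // truncn_ge_nat // expR_ge0.
rewrite -(ler_nat R) -addn1 natrD in lt *; move: lt; lra.
Qed.

(** With [X = Y ^ q] and [A = Z ^ q], the equations [X ^ (s+1) A = n / K] and [A ^ (t+1) X = m / K]
    become linear in logarithms, with determinant [s t + s + t] and solution [y'], [z']. The first
    alternative covers scales below [Y0]. *)
Lemma balanced_scales (R : realType) (s t q K Y0 : nat) (e : R) :
    (0 < t <= s)%N -> (0 < q)%N -> (0 < K)%N -> (0 < Y0)%N -> 0 <= e ->
    (1 + q%:R^-1) * ((s + t)%:R / (2 * (s * t + s + t)%:R)) <= 1 - e ->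
    e * (s + 2)%:R <= (s + 1)%:R ->
  exists2 c : R, 0 < c & forall n m, (0 < m <= n)%N ->
    c * (m * n)%:R `^ e <= n%:R \/
    exists Y Z, [/\ (Y0 <= Y)%N /\ (Y0 <= Z)%N,
      (Y ^ (s * q - 1) * (K * (Y * Z) ^ q) <= n)%N,
      (Z ^ (t * q - 1) * (K * (Y * Z) ^ q) <= m)%N &
      c * (m * n)%:R `^ e <= (Y ^ (s * q - 1) * Z ^ (t * q - 1) * (Y * Z) ^ q)%:R].
Proof.
move=> /andP[t0 ts] q0 K0 Y00 e0 he1 he2.
set Dl : R := (s * t + s + t)%:R in he1 *.
pose a := (s.+1 * q - 1)%N; pose b := (t.+1 * q - 1)%N.
pose l : R := ln K%:R; pose lam : R := ln Y0%:R; pose kap := Dl * q%:R * lam.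
have l0 : 0 <= l by rewrite ln_ge0 // ler1n.
have lam0 : 0 <= lam by rewrite ln_ge0 // ler1n.
have Dl0 : 0 < Dl by rewrite ltr0n; lia.
have q0' : 0 < q%:R :> R by rewrite ltr0n.
have kap0 : 0 <= kap by apply: mulr_ge0 => //; apply: mulr_ge0; exact: ltW.
have s1 : 1 <= s%:R :> R by rewrite ler1n; lia.
have t1 : 1 <= t%:R :> R by rewrite ler1n; lia.
have ts' : t%:R <= s%:R :> R by rewrite ler_nat.
have ln2 : 0 <= ln 2 :> R by rewrite ln_ge0 // ler1n.
(* The last term pays for rounding [Y] and [Z], whose total exponents in the incidence count are [a]
   and [b]; [2 * l] pays for [K]; the first two terms cover scales below [Y0]. *)
pose C := kap + (s%:R + 1) * l + 2 * l + (a + b)%:R * ln 2.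
have ab0 : 0 <= (a + b)%:R * ln 2 :> R by rewrite mulr_ge0.
have e1 : e <= 1.
  rewrite -(@ler_pM2r _ (s + 2)%:R) ?ltr0n ?addn_gt0 ?orbT // mul1r.
  by apply: le_trans he2 _; rewrite ler_nat leq_add2l.
exists (expR (- C)); first exact: expR_gt0.
move=> n m /andP[m0 mn]; have n0 := leq_trans m0 mn.
pose N : R := ln n%:R; pose M : R := ln m%:R.
have N0 : 0 <= N by rewrite ln_ge0 // ler1n.
have M0 : 0 <= M by rewrite ln_ge0 // ler1n.
have MN : M <= N by rewrite ler_ln ?posrE ?ltr0n // ler_nat.
have -> : expR (- C) * (m * n)%:R `^ e = expR (e * (M + N) - C).
  rewrite /powR pnatr_eq0 muln_eq0 !gtn_eqF //= -expRD.
  by rewrite natrM lnM ?posrE ?ltr0n // addrC.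
rewrite (natr_expR_ln R n0) -/N ler_expR.
have eN : e * (M + N) <= M + N by rewrite ler_piMl // addr_ge0.
pose u := N - l; pose v := M - l.
pose y' := ((t%:R + 1) * u - v) / Dl; pose z' := ((s%:R + 1) * v - u) / Dl.
pose y := y' / q%:R; pose z := z' / q%:R.
have DE : Dl = s%:R * t%:R + s%:R + t%:R by rewrite /Dl !natrD natrM.
have yE : Dl * y' = (t%:R + 1) * u - v by rewrite mulrC divfK ?gt_eqF.
have zE : Dl * z' = (s%:R + 1) * v - u by rewrite mulrC divfK ?gt_eqF.
have qy : q%:R * y = y' by rewrite mulrC divfK ?gt_eqF.
have qz : q%:R * z = z' by rewrite mulrC divfK ?gt_eqF.
have uE : (s%:R + 1) * y' + z' = u.
  apply: (mulfI (lt0r_neq0 Dl0)); rewrite mulrDr mulrCA yE zE DE; ring.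
have vE : (t%:R + 1) * z' + y' = v.
  apply: (mulfI (lt0r_neq0 Dl0)); rewrite mulrDr mulrCA yE zE DE; ring.
(* As [M <= N] and [t >= 1], a small [y] bounds both [n] and [m]. *)
have [ylam|ylam] := ltP y lam.
  left.
  have : (t%:R + 1) * u - v < kap.
    by rewrite -yE -qy mulrA ltr_pM2l // mulr_gt0.
  rewrite /C /u /v; nra.
(* A small [z] bounds [m ^ (s+1)] by a constant times [n]; then [e (s+2) <= s+1] bounds [(m n) ^ e]
   by a constant times [n]. *)
have [zlam|zlam] := ltP z lam.
  left.
  have : (s%:R + 1) * v - u < kap.
    by rewrite -zE -qz mulrA ltr_pM2l // mulr_gt0.
  rewrite /u /v !natrD in he2 * => h.
  have h1 : e * ((s%:R + 1) * M) <= e * (N + kap + s%:R * l).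
    by apply: ler_wpM2l => //; lra.
  have h2 := ler_wpM2r N0 he2.
  have sl0 : 0 <= s%:R * l by rewrite mulr_ge0.
  have h3 : e * (kap + s%:R * l) <= kap + s%:R * l by rewrite ler_piMl // addr_ge0.
  have h4 : kap + s%:R * l <= C by rewrite /C; lra.
  have h5 : C <= (s%:R + 1) * C by rewrite ler_peMl //; lra.
  have : (s%:R + 1) * (e * (M + N) - C) <= (s%:R + 1) * N by lra.
  by rewrite ler_pM2l //; lra.
right.
have y0 : 0 <= y by apply: le_trans lam0 ylam.
have z0 : 0 <= z by apply: le_trans lam0 zlam.
have [Y Y0Y /andP[Yl Yu]] := exists_natr_expR Y00 ylam.
have [Z Z0Z /andP[Zl Zu]] := exists_natr_expR Y00 zlam.
have upow (S k : nat) (w : R) : S%:R <= expR w -> (S ^ k)%:R <= expR (k%:R * w).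
  by move=> Sw; rewrite natrX expRM_natl lerXn2r // ?nnegrE ?expR_ge0.
have lpow (S k : nat) (w : R) : expR w <= S%:R -> expR (k%:R * w) <= (S ^ k)%:R.
  by move=> Sw; rewrite natrX expRM_natl lerXn2r // ?nnegrE ?expR_ge0.
have uprod (S T : nat) (w w' : R) : S%:R <= expR w -> T%:R <= expR w' ->
    (S * T)%:R <= expR (w + w').
  by move=> Sw Tw; rewrite natrM expRD ler_pM.
have lprod (S T : nat) (w w' : R) : expR w <= S%:R -> expR w' <= T%:R ->
    expR (w + w') <= (S * T)%:R.
  by move=> Sw Tw; rewrite natrM expRD ler_pM ?expR_ge0.
have Ku : K%:R <= expR l :> R by rewrite natr_expR_ln.
have kq (k : nat) (w : R) : (0 < k)%N -> (k * q - 1)%:R * w = k%:R * (q%:R * w) - w.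
  by move=> k0; rewrite natrB ?muln_gt0 ?k0 // natrM; ring.
exists Y, Z; split=> //.
- rewrite -(ler_nat R) (natr_expR_ln R n0).
  apply: le_trans (uprod _ _ _ _ (upow _ _ _ Yu) (uprod _ _ _ _ Ku
    (upow _ _ _ (uprod _ _ _ _ Yu Zu)))) _.
  rewrite ler_expR kq ?(leq_trans t0) // mulrDr qy qz; move: uE; rewrite -/N /u; lra.
- rewrite -(ler_nat R) (natr_expR_ln R m0).
  apply: le_trans (uprod _ _ _ _ (upow _ _ _ Zu) (uprod _ _ _ _ Ku
    (upow _ _ _ (uprod _ _ _ _ Yu Zu)))) _.
  rewrite ler_expR kq // mulrDr qy qz; move: vE; rewrite -/M /v; lra.
apply: le_trans (lprod _ _ _ _ (lprod _ _ _ _ (lpow _ _ _ Yl) (lpow _ _ _ Zl))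
    (lpow _ _ _ (lprod _ _ _ _ Yl Zl))).
rewrite ler_expR !kq ?(leq_trans t0) //.
have abE : (a + b)%:R = (s%:R + 1) * q%:R - 1 + ((t%:R + 1) * q%:R - 1) :> R.
  by rewrite natrD !natrB ?muln_gt0 // !natrM -!natr1; ring.
have sum0 : 0 <= u + v.
  have : 0 <= y' by rewrite -qy mulr_ge0.
  have : 0 <= z' by rewrite -qz mulr_ge0.
  rewrite -uE -vE => ? ?; rewrite !addr_ge0 // mulr_ge0 //; lra.
(* Here [Dl (y' + z') = t u + s v], which is at most [(s + t) (u + v) / 2] because [s >= t] and
   [u >= v]. *)
have key : (1 + q%:R^-1) * (y' + z') <= (1 - e) * (u + v).
  apply: le_trans (ler_wpM2r sum0 he1); rewrite -[leRHS]mulrA.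
  apply: ler_wpM2l; first by rewrite addr_ge0 ?invr_ge0.
  rewrite mulrAC ler_pdivlMr ?mulr_gt0 //.
  have -> : (y' + z') * (2 * Dl) = 2 * (Dl * y' + Dl * z') by ring.
  rewrite yE zE natrD.
  have : 0 <= (s%:R - t%:R) * (u - v) by rewrite mulr_ge0 // /u /v; lra.
  lra.
have yq : y = q%:R^-1 * y' by rewrite mulrC.
have zq : z = q%:R^-1 * z' by rewrite mulrC.
have el : e * l <= l by rewrite ler_piMl.
have sl0 : 0 <= s%:R * l by rewrite mulr_ge0.
have uvE : u + v = M + N - 2 * l by rewrite /u /v; ring.
have expand : (1 + q%:R^-1) * (y' + z') = y' + z' + (y + z) by rewrite yq zq; ring.
rewrite uvE expand in key.
have -> : s%:R * (q%:R * (y - ln 2)) - (y - ln 2) +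
    (t%:R * (q%:R * (z - ln 2)) - (z - ln 2)) + q%:R * (y - ln 2 + (z - ln 2)) =
    (s%:R * y' + y') + (t%:R * z' + z') - (y + z) - (a + b)%:R * ln 2.
  by rewrite -qy -qz abE; ring.
rewrite /C; move: uE vE; rewrite /u /v; lra.
Qed.

(** * Comparison of exponents *)

(** The left side is [2d / (d^2 + 4d - 1)] for odd [d] and [2 / (d + 4)] for even [d].
    Cross-multiplying leaves [(d - 3) (d + 1) >= 0] and [d (d - 2) >= 0], with equality at [d = 3]
    and [d = 2]. *)
Lemma loss_le_inc_exponent (R : realType) (d s t : nat) :
    (2 <= d)%N -> s = (d - d./2)%N -> t = d./2 ->
  (s + t)%:R / (2 * (s * t + s + t)%:R) <= 1 - inc_exponent R d.
Proof.
move=> d2 sd td; rewrite /inc_exponent.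
have t1 : (0 < t)%N by rewrite td half_gt0.
have t1' : 1 <= t%:R :> R by rewrite ler1n.
have dE : d = (odd d + t + t)%N by rewrite -addnA addnn td odd_double_half.
have sE : s = (odd d + t)%N by rewrite sd -td {1}dE addnK.
rewrite sE [X in X%:R](_ : _ = d); last by rewrite [RHS]dE.
case: (odd d) dE => /= dE; rewrite opprB addrC subrK ler_pdivrMr;
  try by rewrite mulr_gt0 // ltr0n; lia.
all: rewrite mulrAC ler_pdivlMr; rewrite dE !(natrD, natrM); try nra.
all: by apply: mulr_gt0; nra.
Qed.

(** This yields [e (s+2) <= s+1], the condition under which a star suffices in the unbalanced
    case. *)
Lemma inv_le_loss (R : realType) (d s t : nat) :
    (2 <= d)%N -> s = (d - d./2)%N -> t = d./2 ->
  (s + 2)%:R^-1 <= (s + t)%:R / (2 * (s * t + s + t)%:R) :> R.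
Proof.
move=> d2 sd td.
have t1 : (0 < t)%N by rewrite td half_gt0.
have t1' : 1 <= t%:R :> R by rewrite ler1n.
have dE : d = (odd d + t + t)%N by rewrite -addnA addnn td odd_double_half.
have sE : s = (odd d + t)%N by rewrite sd -td {1}dE addnK.
rewrite sE ler_pdivlMr ?mulr_gt0 ?ltr0n //; last by lia.
rewrite mulrC ler_pdivrMr ?ltr0n; last by lia.
by case: (odd d) => /=; rewrite !(natrD, natrM); nra.
Qed.

(** Any [q] with [1 / q <= eps] works. Cutting [e] off at 0 is harmless because [x <= 1 / 2] and
    [1 / q <= 1]. *)
Lemma exists_exponent_slack (R : realType) (x al eps : R) :
    0 < eps -> 0 <= x -> x <= 1 / 2 -> x <= 1 - al ->
  exists q : nat, exists e : R, [/\ (0 < q)%N, 0 <= e, al - eps <= e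
    & (1 + q%:R^-1) * x <= 1 - e].
Proof.
move=> eps0 x0 x2 xal.
exists (Num.truncn eps^-1).+1, (Num.max 0 (al - eps)); split=> //.
- by rewrite le_max lexx.
- by rewrite le_max lexx orbT.
set q := _.+1.
have q1 : q%:R^-1 <= eps.
  by rewrite invf_ple ?posrE ?ltr0n // ltW // truncnS_gt.
have q2 : q%:R^-1 <= 1 :> R by rewrite invf_le1 ?ltr0n // ler1n.
have q0 : 0 <= q%:R^-1 :> R by rewrite invr_ge0.
by have [le|lt] := leP 0 (al - eps); nra.
Qed.

(** * Configurations from evasive sets, and stars *)

(** Orthogonal row spaces have ranks adding up to at most [D], whereas evasiveness forces at least
    [(D - s + 1) + (D - t + 1) = D + 1]. *)
Lemma evasive_config (R : realType) (D X A n m r s t : nat)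
    (U : {set grid D X}) (V : {set grid D A}) :
    (s <= D)%N -> (t <= D)%N -> (s + t = D.+1)%N ->
    evasive R r (D - s) U -> evasive R r (D - t) V ->
    (#|U| * (D.+1 * (X * A)) <= n)%N -> (#|V| * (D.+1 * (X * A)) <= m)%N ->
  exists (P : 'I_n -> 'rV[R]_D.+1) (H : 'I_m -> 'rV[R]_D.+1 * R),
    [/\ injective P,
        forall j, is_hyperplane (H j),
        forall j j', same_hyp (H j) (H j') -> j = j',
        ~ contains_Krr r.+1 P H &
        (#|U| * (X * A) * #|V| <= inc P H)%N].
Proof.
move=> sD tD stD Ue Ve Un Vm.
apply: (@lattice_config _ _ _ _ _ (D * (X * A))).
- move=> x a _ _; rewrite -[X in (_ <= X * _)%N]card_ord -sum_nat_const.
  by apply: leq_sum => j _; rewrite mulnC leq_mul // ltnW.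
- by apply: leq_trans Un; rewrite leq_mul // leq_pmull.
- by rewrite addnC -mulSn.
move=> x a xi ai xU aV /mulmx0_rank_max; rewrite mxrank_tr.
have := Ue x xi xU; have := Ve a ai aV; lia.
Qed.

Definition diagonal (D X : nat) : {set grid D.+1 X} :=
  [set [ffun=> i] | i : 'I_X].

Lemma card_diagonal (D X : nat) : #|diagonal D X| = X.
Proof.
rewrite card_imset ?card_ord // => i j /ffunP/(_ ord0).
by rewrite !ffunE.
Qed.

(** With one side trivial all products [a.x] vanish, so [y0 = 0] and [l = 1] suffice; the trivial
    side cannot supply [r.+1 >= 2] distinct elements. *)
Lemma star_config (R : realType) (D X A n m r : nat) :
    X = 1%N \/ A = 1%N -> (0 < r)%N -> (X <= n)%N -> (A <= m)%N ->
  exists (P : 'I_n -> 'rV[R]_D.+2) (H : 'I_m -> 'rV[R]_D.+2 * R),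
    [/\ injective P,
        forall j, is_hyperplane (H j),
        forall j j', same_hyp (H j) (H j') -> j = j',
        ~ contains_Krr r.+1 P H &
        (X * A <= inc P H)%N].
Proof.
move=> XA r0 Xn Am.
have [||||P [H [? ? ? ? le]]] := @lattice_config R D.+1 X A 1 0 n m r
    (diagonal D X) (diagonal D A).
- move=> x a _ _; rewrite big1 // => j _.
  by case: XA => e; [move: (x j) | move: (a j)];
    rewrite e => u; rewrite (ord1 u) ?muln0.
- by rewrite card_diagonal muln1.
- by rewrite card_diagonal muln1.
- move=> x a xi ai xD aD; case: XA => e.
  + by have := leq_card x xi; rewrite card_ord card_ffun !card_ord
      [in X in (_ <= X)%N]e exp1n ltnNge r0.
  + by have := leq_card a ai; rewrite card_ord card_ffun !card_ord
      [in X in (_ <= X)%N]e exp1n ltnNge r0.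
by exists P, H; split=> //; move: le; rewrite !card_diagonal muln1.
Qed.

Theorem theorem6 (R : realType) (d : nat) (eps : R) :
  (2 <= d)%N -> 0 < eps < 1 ->
  exists (r : nat) (c : R), 0 < c /\
    forall n m : nat, (0 < n)%N -> (0 < m)%N ->
      exists (P : 'I_n -> 'rV[R]_d) (H : 'I_m -> 'rV[R]_d * R),
        [/\ injective P,
            forall j, is_hyperplane (H j),
            forall j j', same_hyp (H j) (H j') -> j = j',
            ~ contains_Krr r P H &
            c * powR ((m * n)%:R) (inc_exponent R d - eps) <= (inc P H)%:R].
Proof.
case: d => [|[|D]] // d2 /andP[eps0 _].
pose t := D.+2./2; pose s := (D.+2 - t)%N.
have t1 : (0 < t)%N by rewrite half_gt0.
have stD : (s + t = D.+2)%N by rewrite subnK // leq_half_double -addnn; lia.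
have ts : (t <= s)%N by rewrite /s /t; have := odd_double_half D.+2; rewrite -addnn; lia.
pose x : R := (s + t)%:R / (2 * (s * t + s + t)%:R).
have Dl0 : 0 < (s * t + s + t)%:R :> R by rewrite ltr0n; lia.
have x0 : 0 <= x by rewrite divr_ge0 // mulr_ge0.
have x2 : x <= 1 / 2.
  have : (s + t)%:R <= (s * t + s + t)%:R :> R by rewrite ler_nat; lia.
  by rewrite ler_pdivrMr ?mulr_gt0 //; lra.
have [q [e [q0 e0 ale he1]]] := exists_exponent_slack eps0 x0 x2
  (@loss_le_inc_exponent R D.+2 s t d2 erefl erefl).
have he2 : e * (s + 2)%:R <= (s + 1)%:R.
  have xe : x <= 1 - e by apply: le_trans he1; rewrite ler_peMl // lerDl invr_ge0.
  have := le_trans (@inv_le_loss R D.+2 s t d2 erefl erefl) xe.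
  rewrite -[(s + 2)%:R^-1]mul1r ler_pdivrMr ?ltr0n ?addn2 //.
  by rewrite addn1 -(natr1 s.+1); lra.
(* Large enough for both evasive sets, whose codimensions are below [D.+2]; the successor makes [r]
   positive for the stars. *)
pose r := (q * D.+1 * D.+2).+1.
have [Y1 Y10 YU] : exists2 Y0, (0 < Y0)%N & forall Y, (Y0 <= Y)%N ->
    exists U : {set grid D.+1 (Y ^ q)},
    [/\ #|U| <= Y ^ (s * q - 1), Y ^ (s * q - 1) <= r.+1 * #|U|
        & evasive R r (D.+1 - s) U]%N.
  apply: exists_evasive_power => //; first by lia.
  by apply: leqW; rewrite leq_mul2l; apply/orP; right; lia.
have [Z1 Z10 ZV] : exists2 Y0, (0 < Y0)%N & forall Y, (Y0 <= Y)%N ->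
    exists U : {set grid D.+1 (Y ^ q)},
    [/\ #|U| <= Y ^ (t * q - 1), Y ^ (t * q - 1) <= r.+1 * #|U|
        & evasive R r (D.+1 - t) U]%N.
  apply: exists_evasive_power => //; first by lia.
  by apply: leqW; rewrite leq_mul2l; apply/orP; right; lia.
have ts' : (0 < t <= s)%N by rewrite t1.
have M0 : (0 < maxn Y1 Z1)%N by rewrite leq_max Y10.
(* [K] is [D.+2], the factor in the number of intercepts per slope in [evasive_config]. *)
have [c c0 scales] := @balanced_scales R s t q D.+2 _ e ts' q0 isT M0 e0 he1 he2.
(* Each of the two evasive sets may fall short of its target size by a factor [r.+1]. *)
exists r.+1, (c / (r.+1 ^ 2)%:R); split; first by rewrite divr_gt0 // ltr0n expn_gt0.
have r0 : (0 < r)%N by [].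
have r2 : 0 < (r.+1 ^ 2)%:R :> R by rewrite ltr0n expn_gt0.
have bound (n m i : nat) (p : R) : (0 < n)%N -> (0 < m)%N ->
    c * (m * n)%:R `^ e <= p -> p <= (r.+1 ^ 2 * i)%:R ->
    c / (r.+1 ^ 2)%:R * (m * n)%:R `^ (inc_exponent R D.+2 - eps) <= i%:R.
  move=> n0 m0 cp pi; rewrite mulrAC ler_pdivrMr // -natrM [(i * _)%N]mulnC.
  apply: le_trans pi; apply: le_trans cp; rewrite ler_pM2l //.
  by apply: ler_powR => //; rewrite ler1n muln_gt0 m0.
have star (n i : nat) : (n <= i)%N -> n%:R <= (r.+1 ^ 2 * i)%:R :> R.
  by move=> ni; rewrite ler_nat (leq_trans ni) // leq_pmull // expn_gt0.
have grids (Y Z u v i : nat) : (Y ^ (s * q - 1) <= r.+1 * u)%N ->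
    (Z ^ (t * q - 1) <= r.+1 * v)%N -> (u * (Y * Z) ^ q * v <= i)%N ->
    (Y ^ (s * q - 1) * Z ^ (t * q - 1) * (Y * Z) ^ q)%:R <= (r.+1 ^ 2 * i)%:R :> R.
  move=> yu zv le; rewrite ler_nat.
  apply: (@leq_trans (r.+1 ^ 2 * (u * (Y * Z) ^ q * v))); last by rewrite leq_mul2l le orbT.
  rewrite (_ : _ ^ 2 * _ = r.+1 * u * (r.+1 * v) * (Y * Z) ^ q)%N; last by ring.
  by rewrite leq_mul // leq_mul.
have sD : (s <= D.+1)%N by lia.
have tD : (t <= D.+1)%N by lia.
move=> n m n0 m0; have [mn|nm] := leqP m n.
- have [|triv|[Y [Z [[YY ZZ] Yn Zm le]]]] := scales n m; first by rewrite m0.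
    have [P [H [Pi Hh Hi Hk le]]] :=
      @star_config R D n 1 n m r (or_intror erefl) r0 (leqnn n) m0.
    exists P, H; split=> //; apply: bound triv (star _ _ _) => //.
    by rewrite -[X in (X <= _)%N]muln1.
  move: YY ZZ; rewrite !geq_max => /andP[/YU[U [Un Ul Ue]] _] /andP[_ /ZV[V [Vn Vl Ve]]].
  have [||P [H [Pi Hh Hi Hk le']]] :=
    @evasive_config R D.+1 _ _ n m r s t U V sD tD stD Ue Ve.
  + by apply: leq_trans Yn; rewrite expnMn leq_mul2r Un orbT.
  + by apply: leq_trans Zm; rewrite expnMn leq_mul2r Vn orbT.
  exists P, H; split=> //; apply: bound le (grids _ _ _ _ _ Ul Vl _) => //.
  by rewrite expnMn.
(* For [n < m] the roles are exchanged: the points now use the set of parameter [t], the hyperplanes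
   that of parameter [s]. *)
- have [|triv|[Y [Z [[YY ZZ] Yn Zm le]]]] := scales m n; first by rewrite n0 ltnW.
    have [P [H [Pi Hh Hi Hk le]]] :=
      @star_config R D 1 m n m r (or_introl erefl) r0 n0 (leqnn m).
    exists P, H; split=> //; rewrite mulnC; apply: bound triv (star _ _ _) => //.
    by rewrite -[X in (X <= _)%N]mul1n.
  move: YY ZZ; rewrite !geq_max => /andP[/YU[V [Vn Vl Ve]] _] /andP[_ /ZV[U [Un Ul Ue]]].
  rewrite addnC in stD.
  have [||P [H [Pi Hh Hi Hk le']]] :=
    @evasive_config R D.+1 _ _ n m r t s U V tD sD stD Ue Ve.
  + by apply: leq_trans Zm; rewrite expnMn (mulnC (Z ^ q)%N) leq_mul2r Un orbT.
  + by apply: leq_trans Yn; rewrite expnMn (mulnC (Z ^ q)%N) leq_mul2r Vn orbT.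
  exists P, H; split=> //; rewrite mulnC; apply: bound le (grids _ _ _ _ _ Vl Ul _) => //.
  by rewrite expnMn (mulnC (Y ^ q)%N) mulnC mulnA mulnAC.
Qed.
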